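(* Let $n\ge 2$, $d\ge 2$ be integers, let $T\subseteq[n]$ with $t:=|T|$, and let $$s_T:=\sum_{S\subseteq[n]}(-1)^{|S\cap T|}\,d^{-\min(|S|,\,n-|S|)}$$ be the value that the shadow enumerator $s_T(\rho)$ would take on a hypothetical exact AME$(n,d)$ state $\rho$. Suppose $s_T<0$ (so that exact AME$(n,d)$ states do not exist, because they would violate the shadow inequality for $T$). Then $\epsilon$-approximate AME$(n,d)$ states do not exist for any $\epsilon\ge 0$ with $$\epsilon<\sqrt{\frac{-s_T}{f(d,n,t)}},$$ where $$f(d,n,t)=\sum_{l=0}^{\lfloor t/2\rfloor}\ \sum_{k'=0}^{n-t}\binom{t}{2l}\binom{n-t}{k'}\,d^{\,2\max\left(\lfloor \frac n2\rfloor-(2l+k'),\ (2l+k')-\lceil\frac n2\rceil\right)}.$$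
   Context: $[n]=\{1,\dots,n\}$ indexes $n$ qudits with Hilbert space $(\mathbb C^d)^{\otimes n}$. For a pure state $|\psi\rangle$ put $\rho=|\psi\rangle\langle\psi|$ and, for $S\subseteq[n]$, $\rho_S=\mathrm{Tr}_{S^c}\rho$ and $d_S=d^{|S|}$. A pure state is an $\epsilon$-approximate $k$-uniform state if $\mathrm{Tr}\,\rho_S^2\le \frac1{d_S}+\epsilon^2$ for every $S\subseteq[n]$ with $|S|=k$. An $\epsilon$-approximate AME$(n,d)$ state is an $\epsilon$-approximate $\lfloor n/2\rfloor$-uniform state in $(\mathbb C^d)^{\otimes n}$. An exact AME$(n,d)$ state is the case $\epsilon=0$ (all reductions to $\lfloor n/2\rfloor$ parties are maximally mixed); such a state would have $\mathrm{Tr}\rho_S^2=d^{-\min(|S|,n-|S|)}$ for all $S$. The shadow enumerator of a state $\rho$ is $s_T(\rho)=\sum_{S\subseteq[n]}(-1)^{|S\cap T|}\mathrm{Tr}\rho_S^2$. The shadow inequalities (a known result of Rains) state $s_T(\rho)\ge0$ for every quantum state $\rho$ and every $T\subseteq[n]$. *)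

(* Defs.v *)
From mathcomp Require Import all_boot all_order all_algebra.
From mathcomp Require Export complex.
From mathcomp Require Export reals.

Set Implicit Arguments.
Unset Strict Implicit.
Unset Printing Implicit Defensive.

Import Order.TTheory GRing.Theory Num.Theory.

Local Open Scope ring_scope.
Local Open Scope complex_scope.
Local Open Scope sesquilinear_scope.

(* The product basis of a register of d-level systems labelled by I is the set
   of functions I -> 'I_d, so the space of the register has dimension d ^ #|I|;
   vectors and operators are written in this basis, enumerated by enum_rank. *)
Definition basis (d : nat) (I : finType) : finType := {ffun I -> 'I_d}.

Definition ket (R : realType) (d : nat) (I : finType) : Type :=
  'cV[R[i]]_#|basis d I|.

Definition oper (R : realType) (d : nat) (I : finType) : Type :=
  'M[R[i]]_#|basis d I|.

Definition pure_state (R : realType) d (I : finType) (psi : ket R d I) : Prop :=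
  psi ^t* *m psi = 1%:M.

Definition density (R : realType) d (I : finType) (psi : ket R d I) :
  oper R d I := psi *m psi ^t*.

Definition subsystem n (S : {set 'I_n}) : finType := {i : 'I_n | i \in S}.

Definition restr d n (S : {set 'I_n}) (x : basis d 'I_n) :
  basis d (subsystem S) := [ffun i => x (val i)].

(* Tr_{S^c} is the linear map sending the matrix unit |x><y| to
   <y_{S^c}|x_{S^c}> |x_S><y_S|, where x_S is the restriction of x to S. *)
Definition reduced (R : realType) d n (S : {set 'I_n}) (A : oper R d 'I_n) :
  oper R d (subsystem S) :=
  \matrix_(a, b)
    \sum_(x : basis d 'I_n | restr S x == enum_val a)
      \sum_(y : basis d 'I_n
              | (restr S y == enum_val b) && (restr (~: S) x == restr (~: S) y))
        A (enum_rank x) (enum_rank y).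

Definition purity (R : realType) d n (psi : ket R d 'I_n) (S : {set 'I_n}) :
  R[i] :=
  \tr (reduced S (density psi) *m reduced S (density psi)).

(* u <= v in R[i] means that 'Im u = 'Im v and 'Re u <= 'Re v; a purity is
   real, so the bound below is the usual inequality of real numbers. *)
Definition approx_uniform (R : realType) d n (eps : R) (k : nat)
    (psi : ket R d 'I_n) : Prop :=
  pure_state psi /\
  forall S : {set 'I_n}, #|S| = k ->
    purity psi S <= ((d%:R ^+ #|S|)^-1 + eps ^+ 2)%:C.

Definition approx_AME (R : realType) d n (eps : R) (psi : ket R d 'I_n) :
  Prop := approx_uniform eps n./2 psi.

Definition AME_shadow (R : realType) (d n : nat) (T : {set 'I_n}) : R :=
  \sum_(S : {set 'I_n})
    (-1) ^+ #|S :&: T| * (d%:R ^+ minn #|S| (n - #|S|))^-1.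

(* Subtraction in nat is truncated, which is harmless here: for every j, at
   least one of n./2 - j and j - uphalf n is nonnegative as an integer, so the
   maximum is the same as in the integers; uphalf n is the ceiling of n / 2. *)
Definition AME_weight (d n t : nat) : nat :=
  (\sum_(0 <= l < t./2.+1) \sum_(0 <= k < (n - t).+1)
     'C(t, 2 * l) * 'C(n - t, k) *
       d ^ (2 * maxn (n./2 - (2 * l + k)) ((2 * l + k) - uphalf n)))%N.

(* Main.v *)
(** The purity of a pure state [f] over [S] is the correlation of [f x * f y]
    with the function obtained from it by exchanging the coordinates of [x] and
    [y] in [S]. These exchanges form an elementary abelian 2-group of
    permutations of pairs, so the signed sum of the purities is, up to a factor
    [2 ^ n], the squared norm of a projection of [f x * f y]; hence it is
    nonnegative (shadow inequality).
    By Cauchy-Schwarz, enlarging [S] by one site divides the purity at most by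
    [d]. Starting from the empty set, whose purity is 1, this bounds each purity
    from below by its AME value; ending at a set of size [n / 2], it bounds the
    excess of the purity of [S] over its AME value by [d ^ (n / 2 - #|S|)] times
    [eps ^ 2]. A purity is that of the complementary set, which covers the large
    sets. Inserting the lower bounds for odd [#|S :&: T|] and the upper bounds
    for even [#|S :&: T|] contradicts the shadow inequality. *)
Require Import Defs.
From mathcomp Require Import all_boot all_order all_algebra.
From mathcomp Require Import ring zify.

Set Implicit Arguments.
Unset Strict Implicit.
Unset Printing Implicit Defensive.

Import Order.TTheory GRing.Theory Num.Theory.
Local Open Scope ring_scope.

(** * Exchanges of coordinates between two configurations *)

Section Mix.

Variables (d : nat) (I : finType).
Implicit Types (x y z : basis d I) (S A B : {set I}).

Definition mix S x y : basis d I := [ffun i => if i \in S then x i else y i].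

Definition update x (i : I) (c : 'I_d) : basis d I :=
  [ffun j => if j == i then c else x j].

Definition symdiff A B : {set I} := [set i | (i \in A) (+) (i \in B)].

Lemma symdiffK A : involutive (symdiff A).
Proof. by move=> B; apply/setP=> i; rewrite !inE addKb. Qed.

Lemma mix_id S x : mix S x x = x.
Proof. by apply/ffunP=> i; rewrite !ffunE if_same. Qed.

Lemma mix0 x y : mix set0 x y = y.
Proof. by apply/ffunP=> i; rewrite !ffunE inE. Qed.

Lemma mixC S x y : mix (~: S) x y = mix S y x.
Proof. by apply/ffunP=> i; rewrite !ffunE inE; case: (i \in S). Qed.

Lemma mix_mixl S x y z : mix S (mix S x y) z = mix S x z.
Proof. by apply/ffunP=> i; rewrite !ffunE; case: (i \in S). Qed.

Lemma mix_mixr S x y z : mix S x (mix S y z) = mix S x z.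
Proof. by apply/ffunP=> i; rewrite !ffunE; case: (i \in S). Qed.

(** Group law of the exchanges: exchanging over [A] and then over [B] restores the sites in both
    sets. *)
Lemma mix_symdiff A B x y :
  mix B (mix A y x) (mix A x y) = mix (symdiff A B) x y.
Proof.
by apply/ffunP=> i; rewrite !ffunE inE; case: (i \in A); case: (i \in B).
Qed.

Lemma mix_setU1 i S x c z :
  i \notin S -> mix (i |: S) (update x i c) z = mix S x (update z i c).
Proof.
move=> iS; apply/ffunP=> j; rewrite !ffunE !inE.
by case: eqP => [->|_] //=; rewrite (negbTE iS).
Qed.

Lemma sum_mix (V : nmodType) S (F : basis d I -> basis d I -> V) :
  \sum_x \sum_y F (mix S x y) (mix S y x) = \sum_x \sum_y F x y.
Proof.
rewrite !pair_bigA /=.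
pose h (p : basis d I * basis d I) := (mix S p.1 p.2, mix S p.2 p.1).
have hK : involutive h.
  by case=> x y; rewrite /h /= !mix_mixl !mix_mixr !mix_id.
by rewrite [RHS](reindex_inj (inv_inj hK)).
Qed.

(** Swapping the value of [x] at [i] with the free value [c] is an involution of the pairs [(x, c)];
    after this change of variables the sum over [c] is constant. *)
Lemma sum_update (V : nmodType) i (F : basis d I -> V) :
  \sum_x \sum_c F (update x i c) = (\sum_x F x) *+ d.
Proof.
rewrite pair_bigA /=.
pose h (p : basis d I * 'I_d) := (update p.1 i p.2, p.1 i).
have hK : involutive h.
  case=> x c; congr pair; rewrite /= ?ffunE ?eqxx //.
  by apply/ffunP=> j; rewrite !ffunE; case: eqP => [->|].
rewrite (reindex_inj (inv_inj hK)) /=.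
transitivity (\sum_x \sum_(c < d) F x); last first.
  rewrite -sumrMnl; apply: eq_bigr => x _.
  by rewrite sumr_const card_ord.
rewrite pair_bigA /=; apply: eq_bigr => -[x c] _ /=.
by congr F; apply/ffunP=> j; rewrite !ffunE; case: eqP => [->|].
Qed.

End Mix.

(** * The sign as a character of the group of subsets *)

Section Shadow.

Variable I : finType.

(** Modulo 2, the cardinal of the intersection with [T] is a sum of indicators, and these add up
    under symmetric difference. *)
Lemma sign_symdiff (R : pzRingType) (A B T : {set I}) :
  (-1) ^+ #|symdiff A B :&: T| =
  (-1) ^+ #|A :&: T| * (-1) ^+ #|B :&: T| :> R.
Proof.
have card_sum (X : {set I}) : #|X :&: T| = (\sum_(i in T) (i \in X))%N.
  rewrite -sum1_card [RHS]big_mkcond [LHS]big_mkcond.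
  by apply: eq_bigr => i _; rewrite inE andbC; case: (i \in T); case: (i \in X).
rewrite -exprD -signr_odd -[RHS]signr_odd; congr (_ ^+ nat_of_bool _).
rewrite !card_sum -big_split !(big_morph odd oddD (erefl _)).
by apply: eq_bigr => i _; rewrite inE oddD !oddb.
Qed.

End Shadow.

(** * Shadow inequality and size bounds for exchange correlations *)

Section Correlation.

Variables (C : numClosedFieldType) (d : nat) (I : finType).
Variable f : basis d I -> C.
Implicit Types (x y z : basis d I) (S T : {set I}).

(** Expectation, in two copies of [f], of the operator that swaps the sites of [S] between the
    copies. *)
Definition exchange_corr S : C :=
  \sum_x \sum_y (f x * f y)^* * (f (mix S y x) * f (mix S x y)).

(** The exchanges over [S] and over its complement differ by the swap of the whole copies, which
    fixes [f x * f y]. *)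
Lemma exchange_corrC S : exchange_corr (~: S) = exchange_corr S.
Proof.
apply: eq_bigr => x _; apply: eq_bigr => y _.
by rewrite !mixC [f (mix S x y) * _]mulrC.
Qed.

Lemma exchange_corr0 :
  \sum_x (f x)^* * f x = 1 -> exchange_corr set0 = 1.
Proof.
move=> f1; rewrite /exchange_corr.
under eq_bigr => x _ do under eq_bigr => y _ do
  rewrite !mix0 rmorphM mulrACA.
by under eq_bigr => x _ do rewrite -mulr_sumr f1 mulr1.
Qed.

Lemma shadow_ge0 T : 0 <= \sum_S (-1) ^+ #|S :&: T| * exchange_corr S.
Proof.
set s := (X in 0 <= X).
(* Up to the factor [#|{set I}|], [u] is the projection of [f x * f y] onto the part where exchanges
   act through the sign character of [T]. *)
pose u x y :=
  \sum_S (-1) ^+ #|S :&: T| * (f (mix S x y) * f (mix S y x)).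
have -> : s = (#|{set I}|%:R)^-1 * \sum_x \sum_y (u x y)^* * u x y.
  have nz : #|{set I}|%:R != 0 :> C.
    by rewrite pnatr_eq0 -lt0n; apply/card_gt0P; exists set0.
  apply: (mulfI nz); rewrite mulVKf // mulr_natl -sumr_const.
  under [RHS]eq_bigr => x _ do under eq_bigr => y _ do
    rewrite rmorph_sum mulr_suml.
  under [RHS]eq_bigr => x _ do rewrite exchange_big.
  rewrite [RHS]exchange_big; apply: eq_bigr => A _.
  (* For fixed [A], the substitution of [symdiff A B] for [S] shows that the terms of the squared
     norm with first index [A] sum to [s], whatever [A] is. *)
  rewrite /s (reindex_inj (inv_inj (symdiffK A))) /=.
  under [RHS]eq_bigr => x _ do under eq_bigr => y _ do rewrite mulr_sumr.
  under [RHS]eq_bigr => x _ do rewrite exchange_big.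
  rewrite [RHS]exchange_big; apply: eq_bigr => B _ /=.
  rewrite /exchange_corr -(sum_mix A) sign_symdiff mulr_sumr.
  apply: eq_bigr => x _; rewrite mulr_sumr; apply: eq_bigr => y _.
  by rewrite !mix_symdiff !symdiffK [in RHS]rmorphM rmorph_sign mulrACA.
rewrite mulr_ge0 ?invr_ge0 ?ler0n //.
by apply: sumr_ge0 => x _; apply: sumr_ge0 => y _; rewrite mulrC mul_conjC_ge0.
Qed.

(* Up to the factor [d ^ #|S|], the reduced density matrix on [S], written as a
   function of full configurations so that different [S] can be compared. *)
Definition gram S x y : C := \sum_z (f (mix S x z))^* * f (mix S y z).

(** Expanding the square gives a sum over four configurations; after a change of variables the
    summand depends on two of them, and each of the other two contributes a factor
    [#|basis d I|]. *)
Lemma sum_gram S :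
  \sum_x \sum_y `|gram S x y| ^+ 2 =
  exchange_corr S *+ #|basis d I| *+ #|basis d I|.
Proof.
pose H x y := (f x * f y)^* * (f (mix S y x) * f (mix S x y)).
have -> : exchange_corr S *+ #|basis d I| *+ #|basis d I| =
    \sum_x \sum_(z : basis d I) \sum_y \sum_(w : basis d I) H x y.
  rewrite -!sumrMnl; apply: eq_bigr => x _.
  rewrite sumr_const; congr (_ *+ _); rewrite -sumrMnl.
  by apply: eq_bigr => y _; rewrite sumr_const.
(* The dummy [z] is mixed into [x] here, and [w] into [y] below; they become the configurations
   traced out in the two factors of the square. *)
rewrite -(sum_mix S (fun x _ => \sum_y \sum_w H x y)).
apply: eq_bigr => x _.
under eq_bigr => y _ do rewrite normCK /gram mulr_suml.
rewrite exchange_big; apply: eq_bigr => z _ /=.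
rewrite -(sum_mix S (fun y _ => H _ y)); apply: eq_bigr => y _.
rewrite rmorph_sum mulr_sumr; apply: eq_bigr => w _.
rewrite /H !mix_mixl !mix_mixr !rmorphM /= conjCK -!mulrA; congr (_ * _).
by rewrite mulrA mulrC.
Qed.

(** Cauchy-Schwarz against a constant vector, by Lagrange's identity: twice the defect is the sum of
    the squared norms of all [v j - v k]. *)
Lemma sqr_norm_sum_le (J : finType) (v : J -> C) :
  `|\sum_j v j| ^+ 2 <= (\sum_j `|v j| ^+ 2) *+ #|J|.
Proof.
rewrite -subr_ge0 -(pmulrn_lge0 _ (isT : 0 < 2)%N).
have -> : ((\sum_j `|v j| ^+ 2) *+ #|J| - `|\sum_j v j| ^+ 2) *+ 2 =
    \sum_j \sum_k `|v j - v k| ^+ 2.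
  have E j k : `|v j - v k| ^+ 2 =
      `|v j| ^+ 2 + `|v k| ^+ 2 - (v j * (v k)^* + v k * (v j)^*).
    by rewrite !normCK rmorphB /=; ring.
  under [RHS]eq_bigr => j _ do under eq_bigr => k _ do rewrite E.
  have Enn : \sum_j \sum_(k : J) `|v j| ^+ 2 = (\sum_j `|v j| ^+ 2) *+ #|J|.
    by rewrite -sumrMnl; apply: eq_bigr => j _; rewrite sumr_const.
  have Ecr : \sum_j \sum_k v j * (v k)^* = `|\sum_j v j| ^+ 2.
    rewrite normCK rmorph_sum mulr_suml; apply: eq_bigr => j _.
    by rewrite mulr_sumr.
  under eq_bigr => j _ do rewrite sumrB !big_split.
  rewrite sumrB !big_split /= Enn Ecr exchange_big Enn.
  rewrite [\sum_j \sum_k v k * _]exchange_big Ecr.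
  by rewrite mulr2n opprD addrACA.
by apply: sumr_ge0 => j _; apply: sumr_ge0 => k _; rewrite exprn_ge0.
Qed.

(** This is the partial trace over site [i]. The factor [d] counts the values at [i] of the
    configuration [z] in [gram], which the left-hand side ignores. *)
Lemma gram_step i S x y : i \notin S ->
  \sum_c gram (i |: S) (update x i c) (update y i c) = gram S x y *+ d.
Proof.
move=> iS; rewrite exchange_big /gram -(sum_update i); apply: eq_bigr => z _.
by apply: eq_bigr => c _; rewrite !mix_setU1.
Qed.

Lemma exchange_corr_step i S : (0 < d)%N -> i \notin S ->
  exchange_corr S <= d%:R * exchange_corr (i |: S).
Proof.
move=> d0 iS; pose h x y := `|gram (i |: S) x y| ^+ 2.
have h0 x y : 0 <= h x y by rewrite exprn_ge0.
have dR : 0 < d%:R :> C by rewrite ltr0n.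
(* Cauchy-Schwarz bounds this by the terms with [c = c']; adding the other nonnegative terms makes
   the updates of [x] and [y] independent, so that [sum_update] applies to each. *)
have step x y : d%:R * `|gram S x y| ^+ 2 <=
    \sum_c \sum_c' h (update x i c) (update y i c').
  apply: (@le_trans _ _ (\sum_c h (update x i c) (update y i c))); last first.
    by apply: ler_sum => c _; rewrite (bigD1 c) //= lerDl sumr_ge0.
  rewrite -(ler_pM2l dR) mulrA -expr2 -{1}[d%:R]normr_nat -exprMn -normrM.
  rewrite !mulr_natl -(gram_step _ _ iS).
  by apply: le_trans (sqr_norm_sum_le _) _; rewrite card_ord.
have N0 : (0 < #|basis d I|)%N.
  by rewrite card_ffun card_ord expn_gt0 d0.
rewrite -(ler_pM2l dR) -(ler_pMn2r N0) -(ler_pMn2r N0) -!mulrnAr -!sum_gram.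
apply: (@le_trans _ _
    (\sum_x \sum_y \sum_c \sum_c' h (update x i c) (update y i c'))).
  rewrite mulr_sumr; apply: ler_sum => x _.
  by rewrite mulr_sumr; apply: ler_sum => y _.
under eq_bigr => x _ do rewrite exchange_big.
under eq_bigr => x _ do under eq_bigr => c _ do
  rewrite (sum_update i (h (update x i c))).
by rewrite (sum_update i (fun x => (\sum_y h x y) *+ d)) sumrMnl !mulr_natl.
Qed.

Lemma exchange_corr_ge S : (0 < d)%N -> \sum_x (f x)^* * f x = 1 ->
  (d%:R ^+ #|S|)^-1 <= exchange_corr S.
Proof.
move=> d0 f1; have dR : 0 < d%:R :> C by rewrite ltr0n.
have [k] := ubnP #|S|; elim: k S => // k IHk S Sk.
have [->|[i iS]] := set_0Vmem S.
  by rewrite cards0 expr0 invr1 exchange_corr0.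
have cardS := cardsD1 i S; rewrite iS in cardS.
rewrite cardS exprS invfM mulrC ler_pdivrMr // mulrC.
apply: le_trans (IHk (S :\ i) _) _; first by rewrite cardS in Sk.
by rewrite -{2}(setD1K iS) exchange_corr_step // !inE eqxx.
Qed.

Lemma exchange_corr_ge_min S : (0 < d)%N -> \sum_x (f x)^* * f x = 1 ->
  (d%:R ^+ minn #|S| (#|I| - #|S|))^-1 <= exchange_corr S.
Proof.
move=> d0 f1; case: leqP => _; first exact: exchange_corr_ge.
have -> : (#|I| - #|S|)%N = #|~: S| by rewrite [#|~: S|]cardsCs setCK.
by rewrite -exchange_corrC; apply: exchange_corr_ge.
Qed.

(** Each of the [m - #|S|] sites added to reach size [m] costs a factor [d]. *)
Lemma exchange_corr_le m (b : C) S : (0 < d)%N -> (m <= #|I|)%N ->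
  (forall S, #|S| = m -> exchange_corr S <= b) -> (#|S| <= m)%N ->
  exchange_corr S <= d%:R ^+ (m - #|S|) * b.
Proof.
move=> d0 mI Hb; have dR : 0 < d%:R :> C by rewrite ltr0n.
have [k] := ubnP (m - #|S|); elim: k S => // k IHk S Sk.
rewrite leq_eqVlt => /predU1P[Sm|Sm]; first by rewrite Sm subnn mul1r Hb.
have [i iS] : exists i, i \in ~: S.
  by apply/card_gt0P; rewrite cardsCs setCK subn_gt0 (leq_trans Sm).
move: iS; rewrite inE => iS; have cardS : #|i |: S| = #|S|.+1 by rewrite cardsU1 iS.
apply: le_trans (exchange_corr_step d0 iS) _.
rewrite -(subnSK Sm) exprS -mulrA ler_pM2l // -cardS.
apply: IHk; rewrite cardS //.
by rewrite -(subnSK Sm) in Sk.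
Qed.

End Correlation.

(** * The weight as a sum over subsets *)

Section Counting.

Local Open Scope nat_scope.

Lemma sum_subsets_card (I : finType) (A : {set I}) (F : nat -> nat) :
  \sum_(B : {set I} | B \subset A) F #|B| =
  \sum_(0 <= j < #|A|.+1) 'C(#|A|, j) * F j.
Proof.
rewrite big_mkord.
(* The default value of [inord] can occur only for [B] not included in [A], which the sum
   excludes. *)
rewrite (partition_big (fun B : {set I} => inord #|B| : 'I_#|A|.+1) xpredT) //=.
apply: eq_bigr => j _; rewrite -cards_draws -sum_nat_const.
have cardB (B : {set I}) : B \subset A -> (#|B| < #|A|.+1).
  by move=> BA; rewrite ltnS subset_leq_card.
apply: eq_big => [B|B /andP[BA /eqP <-]]; last by rewrite inordK ?cardB.
rewrite inE; case BA: (B \subset A) => //=.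
by rewrite -val_eqE /= inordK ?cardB.
Qed.

Lemma sum_setID (I : finType) (T : {set I}) (F : {set I} -> {set I} -> nat) :
  \sum_(S : {set I}) F (S :&: T) (S :\: T) =
  \sum_(A : {set I} | A \subset T) \sum_(B : {set I} | B \subset ~: T) F A B.
Proof.
rewrite pair_big /=.
rewrite (reindex_onto (fun p : {set I} * {set I} => p.1 :|: p.2)
  (fun S => (S :&: T, S :\: T))) /=; last by move=> S _; rewrite setID.
have key (A B : {set I}) : A \subset T -> B \subset ~: T ->
    (A :|: B) :&: T = A /\ (A :|: B) :\: T = B.
  move=> AT BT; rewrite setIUl setDUl (setIidPl AT) [B :\: T]setDE (setIidPl BT).
  rewrite -[T in B :&: T]setCK -setDE.
  move: AT BT; rewrite -!setD_eq0 => /eqP -> /eqP ->.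
  by rewrite setU0 set0U.
apply: eq_big => [[A B]|[A B]] /=.
  apply/eqP/andP => [[<- <-]|[AT BT]]; last by have [-> ->] := key A B AT BT.
  by rewrite subsetIr setDE subsetIr.
by case/eqP=> -> ->.
Qed.

Lemma sum_even n (F : nat -> nat) :
  \sum_(0 <= j < n.+1 | ~~ odd j) F j = \sum_(0 <= l < n./2.+1) F (2 * l).
Proof.
elim: n => [|n IHn]; first by rewrite big_mkcond !big_nat1.
rewrite big_mkcond big_nat_recr //= -big_mkcond IHn uphalf_half.
(* The new index [n.+1] is even exactly when [n] is odd, which is also when the halved bound
   grows. *)
case on: (odd n); rewrite /= ?addn0 // add1n [RHS]big_nat_recr //=.
by rewrite mul2n doubleS -{2}(odd_double_half n) on.
Qed.

(** In [AME_weight], [2 * l] stands for [#|S :&: T|] and [k] for [#|S :\: T|]; the binomials count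
    the sets [S]. This form can be compared with the shadow sum set by set. *)
Lemma AME_weightE d n (T : {set 'I_n}) :
  AME_weight d n #|T| =
  \sum_(S : {set 'I_n} | ~~ odd #|S :&: T|)
    d ^ (2 * maxn (n./2 - #|S|) (#|S| - uphalf n)).
Proof.
pose W j := d ^ (2 * maxn (n./2 - j) (j - uphalf n)).
rewrite [RHS]big_mkcond.
under eq_bigr => S _ do rewrite -[d ^ _]/(W #|S|) -(cardsID T S).
rewrite (sum_setID T
  (fun A B => if ~~ odd #|A| then W (#|A| + #|B|) else 0)) /=.
(* With the parity test moved into the summand, the outer sum runs over all sizes of subsets of [T],
   as [sum_subsets_card] requires. *)
pose G j := if ~~ odd j then
  \sum_(0 <= k < (n - #|T|).+1) 'C(n - #|T|, k) * W (j + k) else 0.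
have -> : AME_weight d n #|T| = \sum_(0 <= j < #|T|.+1) 'C(#|T|, j) * G j.
  transitivity (\sum_(0 <= j < #|T|.+1 | ~~ odd j) 'C(#|T|, j) * G j).
    rewrite sum_even; apply: eq_bigr => l _.
    rewrite /G mul2n odd_double big_distrr /=; apply: eq_bigr => k _.
    by rewrite mulnA.
  rewrite [LHS]big_mkcond /=; apply: eq_bigr => j _.
  by rewrite /G; case: (odd j); rewrite /= ?muln0.
rewrite -sum_subsets_card; apply: eq_bigr => A _.
rewrite /G; case: ifP => _; last by rewrite big1.
have <- : #|~: T| = n - #|T| by rewrite [LHS]cardsCs setCK card_ord.
by rewrite -(sum_subsets_card _ (fun k => W (#|A| + k))).
Qed.

End Counting.

(** * Purities as exchange correlations, and their bounds *)

Section Purity.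

Local Open Scope complex_scope.
Variables (R : realType) (d n : nat) (psi : ket R d 'I_n).

Definition amp (x : basis d 'I_n) : R[i] := psi (enum_rank x) ord0.

Lemma sum_enum_val (V : nmodType) (J : finType) (F : J -> V) :
  \sum_(a < #|J|) F (enum_val a) = \sum_x F x.
Proof.
rewrite (reindex enum_rank); last by apply: onW_bij; apply: enum_rank_bij.
by apply: eq_bigr => x _; rewrite enum_rankK.
Qed.

Lemma pure_state_amp : pure_state psi -> \sum_x (amp x)^* * amp x = 1.
Proof.
move=> /matrixP/(_ ord0 ord0); rewrite !mxE eqxx mulr1n => <-.
rewrite -(sum_enum_val (fun x => (amp x)^* * amp x)).
by apply: eq_bigr => a _; rewrite /amp !mxE enum_valK.
Qed.

(** The two restrictions determine a configuration, so one of the two sums defining [reduced]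
    collapses to a single term. *)
Lemma restr_eq_mix (S : {set 'I_n}) (x y z : basis d 'I_n) :
  (restr S x == restr S z) && (restr (~: S) x == restr (~: S) y) =
  (x == mix S z y).
Proof.
have restrE (A : {set 'I_n}) (u v : basis d 'I_n) :
    reflect {in A, u =1 v} (restr A u == restr A v).
  apply: (iffP eqP) => [/ffunP uv i iA | uv].
    by have := uv (Sub i iA); rewrite !ffunE.
  by apply/ffunP => i; rewrite !ffunE; apply: uv; apply: valP.
apply/andP/eqP => [[/restrE xz /restrE xy] | ->].
  apply/ffunP => i; rewrite ffunE; case: ifPn => iS; first exact: xz.
  by apply: xy; rewrite inE.
by split; apply/restrE => i; rewrite ?inE !ffunE => iS; rewrite ?iS ?(negbTE iS).
Qed.

Lemma purityE (S : {set 'I_n}) : purity psi S = exchange_corr amp S.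
Proof.
pose g a y := \sum_(x | (restr S x == a) && (restr (~: S) x == restr (~: S) y))
  amp x * (amp y)^*.
have redE a b : reduced S (density psi) a b =
    \sum_(y | restr S y == enum_val b) g (enum_val a) y.
  rewrite mxE (exchange_big_dep (fun y => restr S y == enum_val b)) /=; last first.
    by move=> x y _ /andP[].
  apply: eq_bigr => y yb; apply: eq_big => [x|x _]; first by rewrite yb.
  by rewrite !mxE big_ord1 !mxE.
have gE y z : g (restr S z) y = amp (mix S z y) * (amp y)^*.
  rewrite /g (eq_bigl _ _ (fun x => restr_eq_mix S x y z)).
  by rewrite big_pred1_eq.
rewrite /purity /mxtrace.
pose K a b := (\sum_(y | restr S y == b) g a y) * (\sum_(z | restr S z == a) g b z).
transitivity (\sum_a \sum_b K a b).
  rewrite -(sum_enum_val (fun a => \sum_b K a b)); apply: eq_bigr => a _.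
  rewrite mxE -(sum_enum_val (K _)); apply: eq_bigr => b _.
  by rewrite !redE.
rewrite exchange_big /exchange_corr.
(* The reduced indices [a] and [b] label the fibres of [restr S]; summing over labels and fibres is
   summing over all configurations. *)
rewrite (partition_big (restr S) xpredT) //=; apply: eq_bigr => b _.
transitivity (\sum_a \sum_(y | restr S y == b) \sum_(z | restr S z == a)
    (amp y * amp z)^* * (amp (mix S z y) * amp (mix S y z))).
  apply: eq_bigr => a _; rewrite /K big_distrlr /=.
  apply: eq_bigr => y /eqP <-; apply: eq_bigr => z /eqP <-.
  by rewrite !gE mulrACA [RHS]mulrC rmorphM.
rewrite exchange_big; apply: eq_bigr => y _ /=.
by rewrite [RHS](partition_big (restr S) xpredT).
Qed.

Lemma purity_setC (S : {set 'I_n}) : purity psi (~: S) = purity psi S.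
Proof. by rewrite !purityE exchange_corrC. Qed.

Hypothesis d_gt0 : (0 < d)%N.

Lemma purity_ge_AME (S : {set 'I_n}) : pure_state psi ->
  ((d%:R ^+ minn #|S| (n - #|S|))^-1)%:C <= purity psi S.
Proof.
move=> /pure_state_amp pure; rewrite purityE fmorphV rmorphXn rmorph_nat.
by have := exchange_corr_ge_min S d_gt0 pure; rewrite card_ord.
Qed.

Lemma purity_le_small eps (S : {set 'I_n}) : approx_AME eps psi ->
  (#|S| <= n./2)%N ->
  purity psi S <= ((d%:R ^+ #|S|)^-1 + d%:R ^+ (n./2 - #|S|) * eps ^+ 2)%:C.
Proof.
move=> [_ unif] Sm; rewrite purityE.
have dR : d%:R != 0 :> R by rewrite pnatr_eq0 -lt0n.
pose b : R[i] := ((d%:R ^+ n./2)^-1 + eps ^+ 2)%:C.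
have mI : (n./2 <= #|'I_n|)%N by rewrite card_ord; lia.
have Hb (S' : {set 'I_n}) : #|S'| = n./2 -> exchange_corr amp S' <= b.
  by move=> cS; rewrite -purityE; have := unif S' cS; rewrite cS.
apply: le_trans (exchange_corr_le d_gt0 mI Hb Sm) _.
rewrite /b -(rmorph_nat (real_complex R)) -rmorphXn -rmorphM lecR mulrDr.
(* The accumulated power of [d] turns the main term at size [n./2] exactly into the one at size
   [#|S|]; only the [eps] term is amplified. *)
rewrite lerD2r -{2}(subnK Sm) exprD invfM mulrA mulfV ?mul1r //.
by rewrite expf_neq0.
Qed.

Lemma purity_le_AME eps (S : {set 'I_n}) : approx_AME eps psi ->
  purity psi S <= ((d%:R ^+ minn #|S| (n - #|S|))^-1 +
    (d ^ (2 * maxn (n./2 - #|S|) (#|S| - uphalf n)))%:R * eps ^+ 2)%:C.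
Proof.
move=> ame; have := cardsC S; rewrite card_ord => cardC.
(* Passing to the complement preserves the purity and the [minn], and swaps the two arguments of
   [maxn], since [n - n./2 = uphalf n]. *)
wlog Sm : S cardC / (#|S| <= n./2)%N => [hw|].
  have [|mS] := leqP #|S| n./2; first exact: hw.
  have := hw (~: S); rewrite setCK purity_setC => /(_ _ _)/le_trans; apply.
  - by rewrite addnC.
  - lia.
  - by rewrite le_eqVlt; apply/orP; left; apply/eqP; congr (_^-1 + _ * _)%:C;
      [congr (_ ^+ _)|congr (_ ^ _)%:R]; lia.
apply: le_trans (purity_le_small ame Sm) _; rewrite lecR.
have -> : minn #|S| (n - #|S|) = #|S| by lia.
(* The exponent obtained is [n./2 - #|S|]; it is relaxed here to the doubled exponent of
   [AME_weight]. *)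
rewrite lerD2l ler_wpM2r ?sqr_ge0 // -natrX ler_nat leq_pexp2l //.
lia.
Qed.

End Purity.

Theorem theorem1 (R : realType) (n d : nat) (hn : (2 <= n)%N) (hd : (2 <= d)%N)
  (T : {set 'I_n}) (hT : AME_shadow R d T < 0)
  (eps : R) (heps0 : 0 <= eps)
  (heps : eps < Num.sqrt (- AME_shadow R d T / (AME_weight d n #|T|)%:R)) :
  ~ exists psi : ket R d 'I_n, approx_AME eps psi.
Proof.
case=> psi ame; have [pure _] := ame; have d0 : (0 < d)%N := ltnW hd.
have shadow : 0 <= AME_shadow R d T + (AME_weight d n #|T|)%:R * eps ^+ 2.
  rewrite -ler0c; apply: le_trans (shadow_ge0 (amp psi) T) _.
  rewrite /AME_shadow AME_weightE natr_sum mulr_suml.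
  (* The weight is extended by zero to the sets with odd [#|S :&: T|], where the sign [-1] calls for
     the lower bound, free of [eps]. *)
  rewrite [X in _ + X]big_mkcond -big_split.
  rewrite rmorph_sum; apply: ler_sum => S _ /=.
  rewrite -purityE rmorphD rmorphM rmorph_sign -signr_odd.
  have lo := purity_ge_AME d0 S pure; have up := purity_le_AME d0 S ame.
  case: (odd _); first by rewrite rmorph0 addr0 expr1 !mulN1r lerN2.
  by rewrite expr0 !mul1r -rmorphD.
set s := AME_shadow R d T in hT heps shadow.
set W : R := (AME_weight d n #|T|)%:R in heps shadow.
have q_ge0 : 0 <= - s / W by rewrite divr_ge0 ?oppr_ge0 ?ler0n ?ltW.
have eps_lt : eps ^+ 2 < - s / W.
  by rewrite -(sqr_sqrtr q_ge0) ltr_pXn2r ?nnegrE ?sqrtr_ge0.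
(* For [W = 0] the convention [0^-1 = 0] would make the quotient zero, and no square lies strictly
   below zero. *)
have W_gt0 : 0 < W.
  rewrite lt_def ler0n andbT; apply/eqP => W0; move: eps_lt.
  by rewrite W0 invr0 mulr0 ltNge sqr_ge0.
move: eps_lt; rewrite ltr_pdivlMr // -subr_gt0 -oppr_lt0 opprB opprK.
by rewrite mulrC addrC ltNge shadow.
Qed.
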